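(* Let $c_0\in\mathbb R$ and $f(y)=y+y^2/2$. Let $s>1/2$, $T>0$, $u_0\in H^s(\mathbb S)$, and let $u=u(x,t)\in C([-T,T]:H^s(\mathbb S))$ be the corresponding solution of the periodic problem $$\partial_t u+(1-\partial_x^2)^{-1}(\partial_x u+u\,\partial_x u)=0,\qquad u(x,0)=u_0(x),\quad x\in\mathbb S.$$ Suppose that for some $t_0\in(-T,T)$ and some $a,b\in\mathbb S\cong[0,1)$ with $a<b$ one has $u(a,t_0)=u(b,t_0)=c_0$. If one of the following two conditions holds: (1) $f(u(x,t_0))\le f(c_0)$ for $x\in[a,b]$, $\;f(u(x,t_0))\ge f(c_0)$ for $x\in\mathbb S\setminus[a,b]$, and $\partial_tu(b,t_0)\ge\partial_tu(a,t_0)$; (2) $f(u(x,t_0))\le f(c_0)$ for $x\in\mathbb S\setminus[a,b]$, $\;f(u(x,t_0))\ge f(c_0)$ for $x\in[a,b]$, and $\partial_tu(a,t_0)\ge\partial_tu(b,t_0)$; then $u(x,t)\equiv c_0$.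
   Context: $\mathbb S=\mathbb R/\mathbb Z\cong[0,1)$, and $H^s(\mathbb S)$ is the usual $L^2$-based Sobolev space of real-valued functions. The nonlocal term is understood as $\partial_x(1-\partial_x^2)^{-1}\big(u+\tfrac{u^2}{2}\big)$, where $\partial_x(1-\partial_x^2)^{-1}h=\partial_x\mathcal G*h$ (convolution on $\mathbb S$) with $$\mathcal G(x)=\frac{\cosh(x-\lfloor x\rfloor-1/2)}{2\sinh(1/2)},\qquad \partial_x\mathcal G(x)=\frac{\sinh(x-\lfloor x\rfloor-1/2)}{2\sinh(1/2)} .$$ A solution satisfies $u(t)=u_0-\int_0^t\partial_x(1-\partial_x^2)^{-1}(u+\tfrac{u^2}{2})(t')\,dt'$. It is known (Rosier-Zhang) that for every $s\ge0$, $u_0\in H^s(\mathbb S)$ and $T>0$ there is a unique solution $u\in C([-T,T]:H^s(\mathbb S))$. For $s>1/2$ both $u$ and $\partial_tu$ are continuous on $\mathbb S\times[-T,T]$. *)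

(* Defs.v *)
From HB Require Import structures.
From mathcomp Require Import all_boot all_order all_algebra.
From mathcomp Require Import all_classical all_reals all_analysis.
Set Implicit Arguments.
Unset Strict Implicit.
Unset Printing Implicit Defensive.
Import Order.TTheory GRing.Theory Num.Theory.
Import numFieldNormedType.Exports.
Local Open Scope classical_set_scope.
Local Open Scope ring_scope.

(* Functions on the circle R/Z are represented by 1-periodic functions on R,
   and integrals over the circle by integrals over `[0, 1]. *)

(* |hat f(k)|^2 for the complex Fourier coefficient
   hat f(k) = \int_0^1 f(x) e^{- 2 i pi k x} dx of a real-valued f. *)
Definition fourier_sqr (R : realType) (f : R -> R) (k : int) : R :=
  (\int[@lebesgue_measure R]_(x in `[0, 1])
     (f x * cos (2 * pi * k%:~R * x))) ^+ 2 +
  (\int[@lebesgue_measure R]_(x in `[0, 1])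
     (f x * sin (2 * pi * k%:~R * x))) ^+ 2.

(* The weight 1 + (2 pi k)^2 is the symbol of 1 - d^2/dx^2 on R/Z. *)
Definition sobolev_norm (R : realType) (s : R) (f : R -> R) : \bar R :=
  ((\esum_(k in [set: int])
      ((1 + (2 * pi * k%:~R) ^+ 2) `^ s * fourier_sqr f k)%:E)
   `^ 2^-1)%E.

(* f \in H^s(R/Z), for s >= 0. *)
Definition in_sobolev (R : realType) (s : R) (f : R -> R) : Prop :=
  [/\ periodic f 1,
      f \_ `[0, 1[ \in Lfun (@lebesgue_measure R) 2%:E
    & (sobolev_norm s f < +oo)%E].

(* v \in C([-T, T] : H^s), where v x t is the value at position x, time t. *)
Definition continuous_sobolev (R : realType) (s T : R) (v : R -> R -> R) :
    Prop :=
  (forall t : R, t \in `[- T, T] -> in_sobolev s (v^~ t)) /\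
  (forall t : R, t \in `[- T, T] ->
     sobolev_norm s (fun x => v x tau - v x t)
       @[tau --> within [set` `[- T, T]] (nbhs t)] --> 0%E).

Definition sinh (R : realType) (x : R) : R := (expR x - expR (- x)) / 2.

(* The 1-periodic derivative of the kernel
   G(x) = cosh(x - floor x - 1/2) / (2 sinh(1/2)) of (1 - d^2/dx^2)^-1; at the
   integers, where G has a corner, the value is the right derivative. *)
Definition dG (R : realType) (x : R) : R :=
  sinh (x - (Num.floor x)%:~R - 2^-1) / (2 * sinh 2^-1).

(* d/dx (1 - d^2/dx^2)^-1 h *)
Definition dx_inv_op (R : realType) (h : R -> R) (x : R) : R :=
  \int[@lebesgue_measure R]_(y in `[0, 1]) (dG (x - y) * h y).

(* The integral of g from 0 to t, for t of either sign. *)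
Definition integral_from0 (R : realType) (g : R -> R) (t : R) : R :=
  if 0 <= t then \int[@lebesgue_measure R]_(t' in `[0, t]) g t'
  else - \int[@lebesgue_measure R]_(t' in `[t, 0]) g t'.

Definition flux (R : realType) (y : R) : R := y + y ^+ 2 / 2.

(* Solution of class C([-T, T] : H^s), for s > 1/2, with initial datum u0, of
   u_t + (1 - d^2/dx^2)^-1 (u_x + u u_x) = 0 in its integral form.  An element
   of H^s with s > 1/2 is identified with its continuous representative, so
   that the equation and the values u x t make sense at every point x. *)
Definition bbm_solution (R : realType) (s T : R) (u0 : R -> R)
    (u : R -> R -> R) : Prop :=
  [/\ continuous_sobolev s T u,
      (forall t : R, t \in `[- T, T] -> continuous (u^~ t))
    & forall x t : R, t \in `[- T, T] ->
        u x t = u0 x -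
          integral_from0 (fun t' => dx_inv_op (fun y => flux (u y t')) x) t].

(* Main.v *)
(* At time t0 one has u_t(x, t0) = - (dG * h)(x) with h = f(u(., t0)) - f(c0),
   because dG has mean zero.  The kernel y |-> dG(b - y) - dG(a - y) is negative
   on ]a, b[ and positive outside [a, b], so the sign conditions on h together
   with the one on u_t(b) - u_t(a) force h = 0; by connectedness u(., t0) = c0,
   and uniqueness for the integral equation propagates this to all times.
   The only information on the time dependence of u is continuity in the Sobolev
   norm; it becomes L^2 continuity through the inequality
   ||v||_2^2 <= sum_k |hat v(k)|^2 for continuous v, which follows from the Fejer
   kernel being a positive approximate identity:
   int int v(x) v(y) F_N(x - y) dx dy = N^-1 sum_{j, l < N} |hat v(j - l)|^2. *)
Require Import Defs.
From HB Require Import structures.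
From mathcomp Require Import all_boot all_order all_algebra.
From mathcomp Require Import all_classical all_reals all_analysis.
From mathcomp Require Import measurable_realfun ring lra.
Set Implicit Arguments.
Unset Strict Implicit.
Unset Printing Implicit Defensive.
Import Order.TTheory GRing.Theory Num.Theory.
Import numFieldNormedType.Exports.
Local Open Scope classical_set_scope.
Local Open Scope ring_scope.

(** * Continuous functions and integrals on segments *)

Section ContinuousFunctions.
Context {R : realType}.
Implicit Types f g : R -> R.

Lemma continuous_addf f g : continuous f -> continuous g ->
  continuous (fun x => f x + g x).
Proof. by move=> cf cg x; apply: cvgD; [exact: cf|exact: cg]. Qed.

Lemma continuous_oppf f : continuous f -> continuous (fun x => - f x).
Proof. by move=> cf x; apply: cvgN; exact: cf. Qed.

Lemma continuous_mulf f g : continuous f -> continuous g ->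
  continuous (fun x => f x * g x).
Proof. by move=> cf cg x; apply: cvgM; [exact: cf|exact: cg]. Qed.

Lemma continuous_sqrf f : continuous f -> continuous (fun x => f x ^+ 2).
Proof. by move=> cf; under eq_fun do rewrite expr2; exact: continuous_mulf. Qed.

Lemma continuous_normf f : continuous f -> continuous (fun x => `|f x|).
Proof. by move=> cf x; apply: cvg_norm; exact: cf. Qed.

Lemma continuous_cosf f : continuous f -> continuous (fun x => cos (f x)).
Proof.
by move=> cf x; apply: continuous_comp; [exact: cf|exact: continuous_cos].
Qed.

Lemma continuous_sinf f : continuous f -> continuous (fun x => sin (f x)).
Proof.
by move=> cf x; apply: continuous_comp; [exact: cf|exact: continuous_sin].
Qed.

Lemma continuous_sumf I (r : seq I) (F : I -> R -> R) :
  (forall i, continuous (F i)) -> continuous (fun x => \sum_(i <- r) F i x).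
Proof.
move=> cF; elim: r => [|i r IH].
  by under eq_fun do rewrite big_nil; exact: cst_continuous.
by under eq_fun do rewrite big_cons; exact: continuous_addf.
Qed.

End ContinuousFunctions.

(** The cases on [-%R], [GRing.add _] and [GRing.mul _] catch eta-reduced functions. The remaining
    leaves are closed by [auto] from the continuity hypotheses in context. *)
Ltac solve_continuous := repeat (cbv beta; match goal with
  | |- continuous (fun=> ?c) => exact: cst_continuous
  | |- continuous id => by move=> ?; exact: cvg_id
  | |- continuous (fun x => x) => by move=> ?; exact: cvg_id
  | |- continuous -%R => apply: continuous_oppf
  | |- continuous (GRing.add _) => apply: continuous_addf
  | |- continuous (GRing.mul _) => apply: continuous_mulf
  | |- continuous (fun x => @?f x + @?g x) => apply: continuous_addf
  | |- continuous (fun x => - @?f x) => apply: continuous_oppf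
  | |- continuous (fun x => @?f x * @?g x) => apply: continuous_mulf
  | |- continuous (fun x => @?f x ^+ 2) => apply: continuous_sqrf
  | |- continuous (fun x => `|@?f x|) => apply: continuous_normf
  | |- continuous (fun x => cos (@?f x)) => apply: continuous_cosf
  | |- continuous (fun x => sin (@?f x)) => apply: continuous_sinf
  | |- continuous (fun x => \sum_(i <- ?r) @?F x i) =>
      apply: continuous_sumf; intros ?
  | |- _ => solve [auto]
  end).

Section ScaledDerivative.
Context {R : realType}.
Implicit Types (f : R -> R) (c df x : R).

Lemma is_derive_scale f c df x : is_derive x (1 : R) f df ->
  is_derive x (1 : R) (fun y => c * f y) (c * df).
Proof. exact: (@is_deriveZ R R^o R^o). Qed.

Lemma is_derive_mulr c x : is_derive x (1 : R) (fun y => c * y) c.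
Proof.
by have := is_derive_scale c (is_derive_id x (1 : R)); rewrite mulr1.
Qed.

End ScaledDerivative.

Section SegmentIntegral.
Context {R : realType}.
Implicit Types (f g : R -> R) (a b : R).
Notation mu := (@lebesgue_measure R).

Lemma continuous_integrable f a b : continuous f ->
  mu.-integrable `[a, b] (EFin \o f).
Proof.
move=> cf; apply: continuous_compact_integrable; first exact: segment_compact.
exact: continuous_subspaceT.
Qed.

Lemma Rintegral_segment_cst (c : R) a b : a <= b ->
  \int[mu]_(x in `[a, b]) c = c * (b - a).
Proof.
rewrite le_eqVlt => /predU1P[->|ab].
  by rewrite set_itv1 Rintegral_set1 subrr mulr0.
have E : mu `[a, b]%classic = (b - a)%:E.
  by rewrite lebesgue_measure_itv/= lte_fin ab EFinB.
by rewrite Rintegral_cst//= E.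
Qed.

Lemma Rintegral_sum I (r : seq I) (F : I -> R -> R) a b :
  (forall i, continuous (F i)) ->
  \int[mu]_(x in `[a, b]) (\sum_(i <- r) F i x) =
  \sum_(i <- r) \int[mu]_(x in `[a, b]) F i x.
Proof.
move=> cF; elim: r => [|i r IH].
  rewrite big_nil; under eq_Rintegral do rewrite big_nil.
  by rewrite Rintegral_cst// mul0r.
rewrite big_cons; under eq_Rintegral do rewrite big_cons.
rewrite RintegralD//; first by rewrite IH.
  exact: continuous_integrable.
by apply: continuous_integrable; solve_continuous.
Qed.

Lemma Rintegral_derive f (F : R -> R) a b : a <= b -> continuous f ->
  (forall x, is_derive x (1 : R) F (f x)) ->
  \int[mu]_(x in `[a, b]) f x = F b - F a.
Proof.
rewrite le_eqVlt => /predU1P[->|ab] cf dF.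
  by rewrite set_itv1 Rintegral_set1 subrr.
have cF : continuous F.
  by move=> x; apply/differentiable_continuous/derivable1_diffP; case: (dF x).
rewrite /Rintegral (continuous_FTC2 (F := F) ab)//.
- exact: continuous_subspaceT.
- split.
  + by move=> x _; case: (dF x).
  + exact/cvg_at_right_filter/cF.
  + exact/cvg_at_left_filter/cF.
- by move=> x _; rewrite derive1E; case: (dF x).
Qed.

Lemma Rintegral_continuousZr f a b (c : R) : continuous f ->
  \int[mu]_(x in `[a, b]) (f x * c) = \int[mu]_(x in `[a, b]) f x * c.
Proof. by move=> cf; rewrite RintegralZr//; exact: continuous_integrable. Qed.

End SegmentIntegral.

(** * The Fejer kernel *)

Section FejerKernel.
Context {R : realType}.
Notation mu := (@lebesgue_measure R).
Implicit Types (x y theta : R) (v : R -> R) (k : int) (N j l : nat).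

Let trig_2pi_periodic k x :
  sin (2 * pi * k%:~R * (x + 1)) = sin (2 * pi * k%:~R * x) :> R /\
  cos (2 * pi * k%:~R * (x + 1)) = cos (2 * pi * k%:~R * x) :> R.
Proof.
have pn n z : sin (z + 2 * pi * n%:R) = sin z :> R /\
    cos (z + 2 * pi * n%:R) = cos z :> R.
  have -> : 2 * pi * n%:R = (pi *+ 2) *+ n :> R.
    by rewrite -[in RHS]mulr_natl -[in RHS]mulr_natr; ring.
  by rewrite (periodicn (@sinD2pi R)) (periodicn (@cosD2pi R)).
case: k => n.
  by rewrite mulrDr mulr1; exact: pn.
(* For a negative frequency, adding 2 pi (n+1) to the argument at x + 1 gives back the argument at
   x. *)
rewrite NegzE; set z := _ * (x + 1).
have [<- <-] := pn n.+1 z.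
by have -> : z + 2 * pi * n.+1%:R = 2 * pi * (- n.+1%:Z)%:~R * x;
  rewrite /z ?mulrNz -?pmulrn; [ring|].
Qed.

Lemma sin_2pi_periodic k : periodic (fun x => sin (2 * pi * k%:~R * x) : R) 1.
Proof. by move=> x; case: (trig_2pi_periodic k x). Qed.

Lemma cos_2pi_periodic k : periodic (fun x => cos (2 * pi * k%:~R * x) : R) 1.
Proof. by move=> x; case: (trig_2pi_periodic k x). Qed.

Lemma is_derive_sin_mul w x :
  is_derive x (1 : R) (fun y => sin (w * y)) (w * cos (w * x)).
Proof.
have := is_derive1_comp (is_derive_sin (w * x)) (is_derive_mulr w x).
by rewrite mulrC.
Qed.

Lemma is_derive_cos_mul w x :
  is_derive x (1 : R) (fun y => cos (w * y)) (- w * sin (w * x)).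
Proof.
have := is_derive1_comp (is_derive_cos (w * x)) (is_derive_mulr w x).
by rewrite mulrC mulrN mulNr.
Qed.

Lemma Rintegral_cos_2pi k : k != 0 ->
  \int[mu]_(y in `[0, 1]) cos (2 * pi * k%:~R * y) = 0.
Proof.
move=> k0; set w := 2 * pi * k%:~R.
have w0 : w != 0 by rewrite !mulf_neq0 ?pnatr_eq0 ?intr_eq0// gt_eqF// pi_gt0.
have dF x : is_derive x (1 : R) (fun y => w^-1 * sin (w * y)) (cos (w * x)).
  have := is_derive_scale w^-1 (is_derive_sin_mul w x).
  by rewrite mulrA mulVf// mul1r.
rewrite (@Rintegral_derive _ _ _ _ _ ler01 _ dF); last by solve_continuous.
by have := sin_2pi_periodic k 0; rewrite add0r mulr1 mulr0 sin0 => ->; ring.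
Qed.

Lemma Rintegral_sin_2pi k : \int[mu]_(y in `[0, 1]) sin (2 * pi * k%:~R * y) = 0.
Proof.
have [->|k0] := eqVneq k 0.
  under eq_Rintegral do rewrite mulr0 mul0r sin0.
  by rewrite Rintegral_segment_cst ?mul0r.
set w := 2 * pi * k%:~R.
have w0 : w != 0 by rewrite !mulf_neq0 ?pnatr_eq0 ?intr_eq0// gt_eqF// pi_gt0.
have dF x : is_derive x (1 : R) (fun y => - w^-1 * cos (w * y)) (sin (w * x)).
  have := is_derive_scale (- w^-1) (is_derive_cos_mul w x).
  by rewrite mulrA mulrNN mulVf// mul1r.
rewrite (@Rintegral_derive _ _ _ _ _ ler01 _ dF); last by solve_continuous.
have := cos_2pi_periodic k 0; rewrite add0r mulr1 mulr0 cos0 => ->; ring.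
Qed.

Let cos_2piB k x y : cos (2 * pi * k%:~R * (x - y)) =
  cos (2 * pi * k%:~R * x) * cos (2 * pi * k%:~R * y) +
  sin (2 * pi * k%:~R * x) * sin (2 * pi * k%:~R * y) :> R.
Proof. by rewrite mulrBr cosB. Qed.

Lemma Rintegral_mul_cosB v k x : continuous v ->
  \int[mu]_(y in `[0, 1]) (v y * cos (2 * pi * k%:~R * (x - y))) =
  cos (2 * pi * k%:~R * x) *
    \int[mu]_(y in `[0, 1]) (v y * cos (2 * pi * k%:~R * y)) +
  sin (2 * pi * k%:~R * x) *
    \int[mu]_(y in `[0, 1]) (v y * sin (2 * pi * k%:~R * y)).
Proof.
move=> cv.
rewrite -!RintegralZl; try exact: measurable_itv;
  try by apply: continuous_integrable; solve_continuous.
rewrite -RintegralD//; try by apply: continuous_integrable; solve_continuous.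
by apply: eq_Rintegral => y _; rewrite cos_2piB; ring.
Qed.

Lemma Rintegral_cosB k x :
  \int[mu]_(y in `[0, 1]) cos (2 * pi * k%:~R * (x - y)) = (k == 0)%:R.
Proof.
have [->|k0] := eqVneq k 0.
  under eq_Rintegral do rewrite mulr0 mul0r cos0.
  by rewrite Rintegral_segment_cst// mul1r subr0.
have := @Rintegral_mul_cosB (fun=> 1) k x (@cst_continuous _ _ _).
under eq_Rintegral do rewrite mul1r.
move=> ->; under eq_Rintegral do rewrite mul1r.
under [in X in _ + X]eq_Rintegral do rewrite mul1r.
by rewrite Rintegral_cos_2pi// Rintegral_sin_2pi !mulr0 addr0.
Qed.

(** N times the classical Fejer kernel, in real form: the sum of e^(2 i pi (j - l) theta) over j, l
    < N has vanishing imaginary part. The double sum is kept so that integrating against v(x) v(y)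
    yields the coefficients of v at the frequencies j - l. *)
Definition fejer N theta : R :=
  \sum_(j <- iota 0 N) \sum_(l <- iota 0 N) cos (2 * pi * (j%:Z - l%:Z)%:~R * theta).

(** The addition formula for cos(alpha - beta) turns the double sum into the squared modulus of the
    sum of e^(2 i pi j theta) over j < N, which makes positivity visible. *)
Lemma fejerE N theta : fejer N theta =
  (\sum_(j <- iota 0 N) cos (2 * pi * j%:R * theta)) ^+ 2 +
  (\sum_(j <- iota 0 N) sin (2 * pi * j%:R * theta)) ^+ 2.
Proof.
rewrite /fejer !expr2 !mulr_suml -big_split/=; apply: eq_bigr => j _.
rewrite !mulr_sumr -big_split/=; apply: eq_bigr => l _.
by rewrite -cosB intrB -!pmulrn; congr cos; ring.
Qed.

Lemma fejer_ge0 N theta : 0 <= fejer N theta.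
Proof. by rewrite fejerE addr_ge0// sqr_ge0. Qed.

(* Telescoping 2 sin(pi theta) e^(2 i pi j theta) over j < N bounds the modulus
   of the Dirichlet sum by 1 / |sin(pi theta)|. *)
Lemma fejer_sin_le1 N theta : fejer N theta * sin (pi * theta) ^+ 2 <= 1.
Proof.
rewrite fejerE; set C := \sum_(j <- _) _; set S := \sum_(j <- _) _.
pose s := sin (pi * theta); pose c := cos (pi * theta).
pose t : R := (2 * N%:R - 1) * (pi * theta).
have E1 : 2 * s * C = sin t + s.
  rewrite /C /t; elim: N {C S t} => [|N IH].
    by rewrite big_nil mulr0 mulr0 sub0r mulN1r sinN addNr.
  rewrite -(addn1 N) iotaD big_cat/= big_seq1 mulrDr IH add0n.
  have -> : (2 * (N + 1)%:R - 1) * (pi * theta) =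
      2 * pi * N%:R * theta + pi * theta :> R.
    by rewrite natrD; ring.
  have -> : (2 * N%:R - 1) * (pi * theta) =
      2 * pi * N%:R * theta - pi * theta :> R.
    by ring.
  by rewrite sinB sinD -/s; ring.
have E2 : 2 * s * S = c - cos t.
  rewrite /S /t; elim: N {C S t E1} => [|N IH].
    by rewrite big_nil mulr0 mulr0 sub0r mulN1r cosN subrr.
  rewrite -(addn1 N) iotaD big_cat/= big_seq1 mulrDr IH add0n.
  have -> : (2 * (N + 1)%:R - 1) * (pi * theta) =
      2 * pi * N%:R * theta + pi * theta :> R.
    by rewrite natrD; ring.
  have -> : (2 * N%:R - 1) * (pi * theta) =
      2 * pi * N%:R * theta - pi * theta :> R.
    by ring.
  by rewrite cosB cosD -/s; ring.
have H1 := cos2Dsin2 (pi * theta); have H2 := cos2Dsin2 t.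
have : 4 * ((C ^+ 2 + S ^+ 2) * s ^+ 2) = (sin t + s) ^+ 2 + (c - cos t) ^+ 2.
  by rewrite -E1 -E2; ring.
(* The right-hand side above is at most 4: adding (sin t - s)^2 + (c + cos t)^2 to it gives 2 (sin^2
   t + cos^2 t) + 2 (s^2 + c^2) = 4. *)
have H3 := sqr_ge0 (sin t - s); have H4 := sqr_ge0 (c + cos t).
rewrite -/s in H1 *; rewrite -/c in H1.
nra.
Qed.

(** Only the N diagonal terms j = l have a nonzero mean over a period. *)
Lemma Rintegral_fejer N x : \int[mu]_(y in `[0, 1]) fejer N (x - y) = N%:R.
Proof.
rewrite /fejer Rintegral_sum; last by move=> j; solve_continuous.
under eq_bigr => j _.
  rewrite Rintegral_sum; last by move=> l; solve_continuous.
  under eq_bigr do rewrite Rintegral_cosB.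
over.
rewrite /=; transitivity (\sum_(j <- iota 0 N) (1 : R)).
  apply: eq_big_seq => j jN.
  rewrite (bigD1_seq j)//= ?iota_uniq// subrr eqxx big1 ?addr0// => l lj.
  by rewrite subr_eq0 eqz_nat eq_sym (negbTE lj).
by rewrite big_const_seq count_predT size_iota iter_addr_0.
Qed.

Lemma fejer_continuous N x : continuous (fun y => fejer N (x - y)).
Proof. by rewrite /fejer; solve_continuous. Qed.

(** The addition formula separates x from y in each term, so the inner integrals are constants in x
    and each pair (j, l) contributes the squared cosine and sine coefficients at j - l. *)
Lemma Rintegral_fejer_quadratic N v : continuous v ->
  \int[mu]_(x in `[0, 1]) (v x * \int[mu]_(y in `[0, 1]) (v y * fejer N (x - y))) =
  \sum_(j <- iota 0 N) \sum_(l <- iota 0 N) fourier_sqr v (j%:Z - l%:Z).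
Proof.
move=> cv.
transitivity (\int[mu]_(x in `[0, 1]) \sum_(j <- iota 0 N) \sum_(l <- iota 0 N)
   ((v x * cos (2 * pi * (j%:Z - l%:Z)%:~R * x)) *
      \int[mu]_(y in `[0, 1]) (v y * cos (2 * pi * (j%:Z - l%:Z)%:~R * y)) +
    (v x * sin (2 * pi * (j%:Z - l%:Z)%:~R * x)) *
      \int[mu]_(y in `[0, 1]) (v y * sin (2 * pi * (j%:Z - l%:Z)%:~R * y)))).
  apply: eq_Rintegral => x _; rewrite /fejer.
  under eq_Rintegral do rewrite mulr_sumr.
  rewrite Rintegral_sum; last by move=> j; solve_continuous.
  rewrite mulr_sumr; apply: eq_bigr => j _.
  under eq_Rintegral do rewrite mulr_sumr.
  rewrite Rintegral_sum; last by move=> l; solve_continuous.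
  rewrite mulr_sumr; apply: eq_bigr => l _.
  by rewrite Rintegral_mul_cosB//; ring.
rewrite Rintegral_sum; last by move=> j; solve_continuous.
apply: eq_bigr => j _.
rewrite Rintegral_sum; last by move=> l; solve_continuous.
apply: eq_bigr => l _.
rewrite RintegralD//; try by apply: continuous_integrable; solve_continuous.
rewrite !RintegralZr//; try by apply: continuous_integrable; solve_continuous.
Qed.

End FejerKernel.

(** * Parseval inequality *)

Section Parseval.
Context {R : realType}.
Notation mu := (@lebesgue_measure R).
Implicit Types (v : R -> R) (eta x y : R).

(** A modulus of continuity adapted to the Fejer kernel: by [fejer_sin_le1] the sine term integrates
    against the kernel to at most C, whatever N is, while eta is weighted by the total mass N. The
    bound is checked locally on the compact square for all large C, then made uniform by
    near-covering compactness. *)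
Lemma periodic_modulus v eta : continuous v -> periodic v 1 -> 0 < eta ->
  exists C, forall x y, 0 <= x <= 1 -> 0 <= y <= 1 ->
    `|v x - v y| <= eta + C * sin (pi * (x - y)) ^+ 2.
Proof.
move=> cv pv eta0.
pose g (q : R * R) : R := `|v q.1 - v q.2|.
pose sg (q : R * R) : R := sin (pi * (q.1 - q.2)) ^+ 2.
have cfst : continuous (fst : R * R -> R) by move=> q; exact: cvg_fst.
have csnd : continuous (snd : R * R -> R) by move=> q; exact: cvg_snd.
have cg : continuous g.
  move=> q; apply: cvg_norm; apply: cvgB.
    by apply: (@continuous_comp _ _ _ fst v); [exact: cfst|exact: cv].
  by apply: (@continuous_comp _ _ _ snd v); [exact: csnd|exact: cv].
have csg : continuous sg.
  have cs : continuous (fun z : R => sin (pi * z) ^+ 2) by solve_continuous.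
  move=> q; apply: (@continuous_comp _ _ _ (fun q : R * R => q.1 - q.2)
    (fun z : R => sin (pi * z) ^+ 2)); last exact: cs.
  by apply: cvgB; [exact: cfst|exact: csnd].
have sg_ge0 q : 0 <= sg q by exact: sqr_ge0.
have := (compact_near_coveringP _).1
  (compact_setX (segment_compact (a := 0 : R) (b := 1))
                (segment_compact (a := 0 : R) (b := 1))).
move=> /(_ R (+oo) (fun C q => g q <= eta + C * sg q) _).
case.
  move=> [x0 y0] [/= ]; rewrite !in_itv/= => /andP[x00 x01] /andP[y00 y01].
  (* Where v x0 = v y0, the oscillation stays below eta nearby and any C >= 0 works. *)
  have [v00|v00] := eqVneq (v x0) (v y0).
    have g0 : g (x0, y0) < eta by rewrite /g/= v00 subrr normr0.
    have gn : \forall q \near (x0, y0), g q < eta.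
      exact: (@cvgr_lt R _ (nbhs (x0, y0)) _ g _ (cg _) _ g0).
    exists ([set q | g q < eta], [set C | 0 <= C]).
      by split => //=; exact: nbhs_pinfty_ge.
    move=> [q C] /= [/ltW gq C0].
    by rewrite (le_trans gq)// lerDl mulr_ge0.
  (* The sine vanishes on the square only if x0 - y0 is 0, 1 or -1, and then periodicity would give
     v x0 = v y0. *)
  have s0 : 0 < sg (x0, y0).
    rewrite lt_neqAle sg_ge0 andbT eq_sym /sg/= sqrf_eq0.
    have v01 : v 1 = v 0 by rewrite -(pv 0) add0r.
    have [xy|xy|xy] := ltgtP x0 y0; last by rewrite xy eqxx in v00.
    - rewrite -opprB mulrN sinN oppr_eq0 gt_eqF// sin_gt0_pi//.
      rewrite mulr_gt0 ?pi_gt0 ?subr_gt0//= gtr_pMr ?pi_gt0//.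
      rewrite lt_neqAle; apply/andP; split; last by lra.
      apply: contra_neqN v00 => /eqP h.
      by have [-> ->] : x0 = 0 /\ y0 = 1 by lra.
    - rewrite gt_eqF// sin_gt0_pi//.
      rewrite mulr_gt0 ?pi_gt0 ?subr_gt0//= gtr_pMr ?pi_gt0//.
      rewrite lt_neqAle; apply/andP; split; last by lra.
      apply: contra_neqN v00 => /eqP h.
      by have [-> ->] : x0 = 1 /\ y0 = 0 by lra.
  have gn : \forall q \near (x0, y0), g q < g (x0, y0) + 1.
    by apply: (@cvgr_lt R _ (nbhs (x0, y0)) _ g _ (cg _)); rewrite ltrDl.
  have sn : \forall q \near (x0, y0), sg (x0, y0) / 2 < sg q.
    by apply: (@cvgr_gt R _ (nbhs (x0, y0)) _ sg _ (csg _)); lra.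
  (* Near (x0, y0) the left side is below g (x0, y0) + 1 and the squared sine above half its value
     there; the threshold on C is the quotient of the two. *)
  exists ([set q | g q < g (x0, y0) + 1 /\ sg (x0, y0) / 2 < sg q],
      [set C | (g (x0, y0) + 1) / (sg (x0, y0) / 2) <= C]).
    by split => /=; [exact: filterI gn sn|exact: nbhs_pinfty_ge (num_real _)].
  move=> [q C] /= [[gq sq] CC].
  have := mulr_ge0 (normr_ge0 (v x0 - v y0)) (ltW s0).
  rewrite ler_pdivrMr ?divr_gt0// in CC.
  have : (sg (x0, y0) / 2) * C <= sg q * C.
    apply: ler_wpM2r; last exact: ltW.
    have : 0 <= g (x0, y0) by exact: normr_ge0.
    by move: CC s0; set a := g _; set b := sg _; nra.
  by move: gq CC; set a := g _; set b := sg _; nra.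
(* A neighbourhood of +oo only gives the property strictly above C, hence C + 1. *)
move=> C [_ HC]; exists (C + 1) => x y x01 y01.
by apply: (HC (C + 1) _ (x, y)); [rewrite ltrDl|split; rewrite /= in_itv/=].
Unshelve. all: by end_near. Qed.

Lemma Rintegral_mul_fejer N v x : continuous v ->
  \int[mu]_(y in `[0, 1]) (v y * fejer N (x - y)) =
  \sum_(j <- iota 0 N) \sum_(l <- iota 0 N)
    \int[mu]_(y in `[0, 1]) (v y * cos (2 * pi * (j%:Z - l%:Z)%:~R * (x - y))).
Proof.
move=> cv; rewrite /fejer.
under eq_Rintegral do rewrite mulr_sumr.
rewrite Rintegral_sum; last by move=> j; solve_continuous.
apply: eq_bigr => j _.
under eq_Rintegral do rewrite mulr_sumr.
by rewrite Rintegral_sum => [|l]; [|solve_continuous].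
Qed.

Lemma fejer_convolution_continuous N v : continuous v ->
  continuous (fun x => \int[mu]_(y in `[0, 1]) (v y * fejer N (x - y))).
Proof.
move=> cv; rewrite (funext (fun x => Rintegral_mul_fejer N x cv)).
apply: continuous_sumf => j; apply: continuous_sumf => l.
rewrite (funext (fun x => Rintegral_mul_cosB _ x cv)).
by solve_continuous.
Qed.

(** As the kernel has mass N, the difference is the integral of (v x - v y) times the kernel.
    Positivity and [fejer_sin_le1] bound the integrand by eta times the kernel plus C. *)
Lemma fejer_convolution_dist N v x eta C : continuous v ->
  (forall y, 0 <= y <= 1 -> `|v x - v y| <= eta + C * sin (pi * (x - y)) ^+ 2) ->
  0 <= C ->
  `|v x * N%:R - \int[mu]_(y in `[0, 1]) (v y * fejer N (x - y))| <=
    eta * N%:R + C.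
Proof.
move=> cv vC C0; have cK := @fejer_continuous R N x.
rewrite -(Rintegral_fejer N x) -RintegralZl//; last exact: continuous_integrable.
rewrite -RintegralB//; try by apply: continuous_integrable; solve_continuous.
under eq_Rintegral do rewrite -mulrBl.
apply: (le_trans (le_normr_Rintegral _ _)) => //.
  by apply: continuous_integrable; solve_continuous.
rewrite -RintegralZl//; last exact: continuous_integrable.
have -> : C = \int[mu]_(y in `[0, 1]) C.
  by rewrite Rintegral_segment_cst// subr0 mulr1.
rewrite -RintegralD//; try by apply: continuous_integrable; solve_continuous.
apply: le_Rintegral => //; try by apply: continuous_integrable; solve_continuous.
move=> y; rewrite /= in_itv/= => /vC vxy.
rewrite normrM (ger0_norm (fejer_ge0 _ _)).
have H1 := fejer_ge0 N (x - y); have H2 := fejer_sin_le1 N (x - y).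
have := ler_wpM2r H1 vxy; rewrite mulrDl => /le_trans; apply.
rewrite lerD2l -mulrA [X in _ * X]mulrC -[leRHS]mulr1.
exact: ler_wpM2l.
Qed.

(** Let I be the integral of v^2 and Q the Fejer quadratic form of v. Then Q <= N E and N I - Q <= M
    (eta N + C), where M bounds |v|. Dividing by N, with eta small and then N large, gives I <= E +
    e for every e > 0. *)
Lemma bessel_completeness v (E : R) : continuous v -> periodic v 1 ->
  (forall r : seq int, uniq r -> \sum_(k <- r) fourier_sqr v k <= E) ->
  \int[mu]_(x in `[0, 1]) (v x ^+ 2) <= E.
Proof.
move=> cv pv vE.
have [M M0 vM] : exists2 M : R, 0 < M & forall x, 0 <= x <= 1 -> `|v x| <= M.
  have cnv : {within `[0, 1], continuous (fun x => `|v x|)}.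
    by apply: continuous_subspaceT; solve_continuous.
  have [c _ hc] := EVT_max ler01 cnv.
  exists (`|v c| + 1) => [|x x01]; first by rewrite ltr_wpDl.
  by rewrite ler_wpDr// hc// in_itv.
apply/ler_addgt0Pr => e e0.
have eta0 : 0 < e / 2 / M by rewrite !divr_gt0.
have [C0 HC0] := periodic_modulus cv pv eta0.
(* [periodic_modulus] does not fix the sign of its constant, while [fejer_convolution_dist] asks for
   a nonnegative one. *)
pose C : R := `|C0|.
have HC x y : 0 <= x <= 1 -> 0 <= y <= 1 ->
    `|v x - v y| <= e / 2 / M + C * sin (pi * (x - y)) ^+ 2.
  move=> x01 y01; apply: (le_trans (HC0 x y x01 y01)).
  by rewrite lerD2l ler_wpM2r ?sqr_ge0// ler_norm.
(* Large enough that M C <= e N / 2; the choice eta = e / (2 M) accounts for the other half of e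
   N. *)
pose N := (Num.truncn (2 * M * C / e)).+1.
have N0 : (0 : R) < N%:R by rewrite ltr0n.
have NE : 2 * M * C / e <= N%:R.
  by apply: ltW; exact: truncnS_gt.
set I := \int[mu]_(x in _) _.
pose Q := \int[mu]_(x in `[0, 1])
  (v x * \int[mu]_(y in `[0, 1]) (v y * fejer N (x - y))).
have QE : Q <= N%:R * E.
  rewrite /Q Rintegral_fejer_quadratic//.
  apply: (@le_trans _ _ (\sum_(j <- iota 0 N) E)).
    apply: ler_sum => j _.
    (* For fixed j the frequencies j - l are pairwise distinct, so each inner sum is at most E. *)
    rewrite -(big_map (fun l : nat => j%:Z - l%:Z) xpredT (fourier_sqr v)).
    apply: vE; rewrite map_inj_uniq ?iota_uniq// => l1 l2 /addrI/oppr_inj.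
    by case.
  by rewrite big_const_seq count_predT size_iota iter_addr_0 mulr_natl.
have cF := @fejer_convolution_continuous N _ cv.
have : I * N%:R - Q <= M * (e / 2 / M * N%:R + C).
  rewrite /I -RintegralZr//; last by apply: continuous_integrable; solve_continuous.
  rewrite -RintegralB//; try by apply: continuous_integrable; solve_continuous.
  have -> : M * (e / 2 / M * N%:R + C) =
      \int[mu]_(y in `[0, 1]) (M * (e / 2 / M * N%:R + C)).
    by rewrite Rintegral_segment_cst// subr0 mulr1.
  apply: le_Rintegral => //; try by apply: continuous_integrable; solve_continuous.
  move=> x; rewrite /= in_itv/= => x01.
  rewrite expr2 -mulrA -mulrBr (le_trans (ler_norm _))// normrM.
  apply: ler_pM => //; first exact: vM.
  by apply: fejer_convolution_dist; [|move=> y; exact: HC|exact: normr_ge0].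
have -> : M * (e / 2 / M * N%:R + C) = e / 2 * N%:R + M * C.
  by field; rewrite gt_eqF.
move=> H.
have MC : M * C <= e / 2 * N%:R.
  by move: NE; rewrite ler_pdivrMr//; lra.
rewrite -(ler_pM2r N0); lra.
Qed.

(** For s >= 0 every Sobolev weight is at least 1, so each finite sum of [fourier_sqr] is below the
    squared norm and [bessel_completeness] applies. *)
Lemma sobolev_norm_L2 s v e : 0 <= s -> continuous v -> periodic v 1 ->
  (sobolev_norm s v < e%:E)%E -> \int[mu]_(x in `[0, 1]) (v x ^+ 2) <= e ^+ 2.
Proof.
move=> s0 cv pv; rewrite /sobolev_norm; set S := esum _ _ => Se.
have S0 : (0 <= S)%E.
  apply: esum_ge0 => k _; rewrite lee_fin mulr_ge0 ?powR_ge0//.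
  by rewrite /fourier_sqr addr_ge0// sqr_ge0.
apply: bessel_completeness => // r ur.
have rS : ((\sum_(k <- r) fourier_sqr v k)%:E <= S)%E.
  apply: esum_ge; exists [set` r].
    by split => //; exact: finite_seq.
  rewrite -fsbig_seq// sumEFin lee_fin; apply: ler_sum => k _.
  rewrite ler_peMl//; first by rewrite /fourier_sqr addr_ge0// sqr_ge0.
  have h : 1 <= 1 + (2 * pi * k%:~R) ^+ 2 :> R by rewrite lerDl sqr_ge0.
  have h1 : 1 `^ s = 1 :> R by rewrite powR1.
  by rewrite -[leLHS]h1 ge0_ler_powR// ?nnegrE// (le_trans _ h).
case: S S0 Se rS => [S| |]//=.
- rewrite !lee_fin lte_fin => S0; rewrite powR12_sqrt// => Se rS.
  apply: (le_trans rS); rewrite -(sqr_sqrtr S0) ler_sqr ?nnegrE ?sqrtr_ge0 ?ltW//.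
  exact: le_lt_trans Se.
- by rewrite gt_eqF// invr_gt0.
Qed.

End Parseval.

(** * The Green kernel *)

Section IntegralComparison.
Context {R : realType}.
Notation mu := (@lebesgue_measure R).
Implicit Types (f g : R -> R) (a b c x : R).

Lemma Rintegral_segment_cat f a b c : a <= b -> b <= c ->
  mu.-integrable `[a, c] (EFin \o f) ->
  \int[mu]_(x in `[a, c]) f x =
  \int[mu]_(x in `[a, b]) f x + \int[mu]_(x in `[b, c]) f x.
Proof.
move=> ab bc fi.
have := Rintegral_itvB (x := b) fi; rewrite !bnd_simp => /(_ ab bc).
rewrite Rintegral_itv_obnd_cbnd => [<-|]; first by rewrite addrC subrK.
by apply: integrableS fi => //; apply: subset_itvr; rewrite bnd_simp.
Qed.

Lemma Rintegral_le0_eq0 g : continuous g -> (forall x, 0 <= g x) ->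
  \int[mu]_(x in `[0, 1]) g x <= 0 -> forall x, 0 <= x <= 1 -> g x = 0.
Proof.
move=> cg g0 ig x x01; apply/eqP; rewrite eq_le g0 andbT leNgt; apply/negP => gx.
have : \forall y \near x, g x / 2 < g y.
  by apply: (@cvgr_gt R _ (nbhs x) _ g _ (cg x)); lra.
move=> /nbhs_ballP[d /= d0 hd].
(* Half the radius keeps [p, q] inside the open ball; clipping to [0, 1] leaves p < q even when x is
   an endpoint. *)
pose p := Num.max 0 (x - d / 2); pose q := Num.min 1 (x + d / 2).
have pq : p < q by rewrite gt_max !lt_min; lra.
have [p0 q1] : 0 <= p /\ q <= 1 by rewrite le_max lexx ge_min lexx.
have qx y : p <= y <= q -> g x / 2 <= g y.
  rewrite ge_max le_min => /andP[/andP[_ py] /andP[_ yq]]; apply/ltW/hd.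
  by rewrite /ball/= ltr_norml; lra.
have : g x / 2 * (q - p) <= \int[mu]_(x in `[p, q]) g x.
  rewrite -(@Rintegral_segment_cst _ (g x / 2) _ _ (ltW pq)).
  apply: le_Rintegral => //.
  - by apply: continuous_integrable; solve_continuous.
  - exact: continuous_integrable.
have : \int[mu]_(x in `[p, q]) g x <= \int[mu]_(x in `[0, 1]) g x.
  rewrite (Rintegral_segment_cat (a := 0) (b := p) (c := 1))//; last 2 first.
  - exact: ltW (lt_le_trans pq q1).
  - exact: continuous_integrable.
  rewrite (Rintegral_segment_cat (a := p) (b := q) (c := 1))//; last 2 first.
  - exact: ltW.
  - exact: continuous_integrable.
  rewrite addrCA lerDl addr_ge0//; exact: Rintegral_ge0.
have : 0 < g x / 2 * (q - p) by rewrite mulr_gt0 ?subr_gt0//; lra.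
lra.
Qed.

End IntegralComparison.

Section GreenKernel.
Context {R : realType}.
Notation mu := (@lebesgue_measure R).
Implicit Types (h : R -> R) (a b c k p q x y z : R).

(** From e^q >= 1 + q >= 1/2 one gets e^p - e^q >= e^q (p - q) >= (p - q)/2, and e^(-z) is
    decreasing; the division by 2 in [sinh] produces the 4. *)
Lemma sinhB_ge q p : - 2^-1 <= q -> q <= p -> (p - q) / 4 <= sinh p - sinh q.
Proof.
move=> hq qp; rewrite /sinh.
have H1 : expR p = expR q * expR (p - q) by rewrite -expRD addrC subrK.
have H2 : 1 + (p - q) <= expR (p - q) by exact: expR_ge1Dx.
have H3 : 2^-1 <= expR q by have := expR_ge1Dx q; lra.
have H4 : expR (- p) <= expR (- q) by rewrite ler_expR lerN2.
nra.
Qed.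

Lemma sinhN z : sinh (- z) = - sinh z :> R.
Proof. by rewrite /sinh opprK -mulNr opprB. Qed.

Lemma sinh_half_gt0 : 0 < sinh (2^-1 : R).
Proof.
have z : sinh 0 = 0 :> R by rewrite /sinh oppr0 subrr mul0r.
have h0 : - 2^-1 <= 0 :> R by lra.
have h1 : 0 <= 2^-1 :> R by lra.
by have := sinhB_ge h0 h1; rewrite z; lra.
Qed.

Lemma dG_norm_le1 z : `|dG z| <= 1.
Proof.
have s0 := sinh_half_gt0; rewrite /dG normrM normfV.
have [f1 f2] : (Num.floor z)%:~R <= z /\ z < (Num.floor z)%:~R + 1.
  by have /andP[] := floor_itv z; rewrite intrD.
set w := z - _ - _.
have [w1 w2] : - 2^-1 <= w /\ w <= 2^-1 by rewrite /w; split; lra.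
rewrite (gtr0_norm (_ : 0 < 2 * _)) ?mulr_gt0// ler_pdivrMr ?mulr_gt0// mul1r.
have := @sinhB_ge w 2^-1 w1 w2; have := @sinhB_ge _ w (lexx _) w1.
by rewrite sinhN ler_norml; lra.
Qed.

Lemma dG_ge0E z : 0 <= z < 1 -> dG z = sinh (z - 2^-1) / (2 * sinh 2^-1).
Proof.
by move=> z01; rewrite /dG (@floor_def _ z 0) ?subr0// add0r.
Qed.

Lemma dG_lt0E z : -1 <= z < 0 -> dG z = sinh (z + 2^-1) / (2 * sinh 2^-1).
Proof.
move=> z01; rewrite /dG (@floor_def _ z (-1)) ?addNr//.
by congr (sinh _ / _); lra.
Qed.

Lemma continuous_sinh : continuous (@sinh R).
Proof.
move=> z; rewrite /sinh; apply: cvgM; last exact: cvg_cst.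
apply: cvgB; first exact: continuous_expR.
apply: continuous_comp; last exact: continuous_expR.
exact: opp_continuous.
Qed.

Lemma dG_measurable (D : set R) x : measurable D ->
  measurable_fun D (fun y => dG (x - y)).
Proof.
move=> mD.
apply: measurable_funM; last exact: measurable_cst.
apply: (@measurableT_comp _ _ _ _ _ _ (@sinh R)).
  by apply: continuous_measurable_fun; exact continuous_sinh.
apply: measurable_funB; last exact: measurable_cst.
apply: measurable_funB.
  by apply: measurable_funB; [exact: measurable_cst|exact: measurable_id].
apply: nonincreasing_measurable => // y z yz.
by rewrite ler_int; apply: le_floor; rewrite lerD2l lerN2.
Qed.

Lemma dG_integrable h x : continuous h ->
  mu.-integrable `[0, 1] (EFin \o (fun y => dG (x - y) * h y)).
Proof.
move=> ch; apply: (le_integrable _ _ _ (@continuous_integrable _ h 0 1 ch)) => //.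
  apply/measurable_EFinP; apply: measurable_funM; first exact: dG_measurable.
  by apply: measurable_funTS; apply: continuous_measurable_fun; exact ch.
move=> y _; rewrite /= lee_fin normrM -[leRHS]mul1r ler_wpM2r//.
exact: dG_norm_le1.
Qed.

Lemma dx_inv_opB h1 h2 x : continuous h1 -> continuous h2 ->
  dx_inv_op h1 x - dx_inv_op h2 x = dx_inv_op (fun y => h1 y - h2 y) x.
Proof.
move=> c1 c2; rewrite /dx_inv_op -RintegralB//; try exact: dG_integrable.
by apply: eq_Rintegral => y _; rewrite mulrBr.
Qed.

Lemma dx_inv_op_norm h x : continuous h ->
  `|dx_inv_op h x| <= \int[mu]_(y in `[0, 1]) `|h y|.
Proof.
move=> ch; apply: (le_trans (le_normr_Rintegral _ (dG_integrable x ch))) => //.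
apply: le_Rintegral => //.
- by have := integrable_norm (dG_integrable x ch).
- by apply: continuous_integrable; solve_continuous.
- by move=> y _; rewrite normrM -[leRHS]mul1r ler_wpM2r// dG_norm_le1.
Qed.

Lemma is_derive_expR_Br k y :
  is_derive y (1 : R) (fun z => expR (k - z)) (- expR (k - y)).
Proof.
have H : is_derive y (1 : R) (fun z => k - z) (- 1).
  have := is_deriveB (is_derive_cst k y (1 : R)) (is_derive_id y (1 : R)).
  by rewrite sub0r.
have := @is_derive1_comp R expR (fun z => k - z) y _ _
  (is_derive_expR (k - y)) H.
by rewrite mulrN1.
Qed.

Lemma is_derive_expR_Bl k y :
  is_derive y (1 : R) (fun z => expR (- (k - z))) (expR (- (k - y))).
Proof.
have H : is_derive y (1 : R) (fun z => - (k - z)) 1.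
  have := is_deriveB (is_derive_id y (1 : R)) (is_derive_cst k y (1 : R)).
  rewrite subr0.
  by under [in X in _ -> X]eq_fun do rewrite opprB.
have := @is_derive1_comp R expR (fun z => - (k - z)) y _ _
  (is_derive_expR (- (k - y))) H.
by rewrite mulr1.
Qed.

Lemma continuous_sinhB k : continuous (fun y => sinh (k - y)).
Proof.
move=> y; apply: (@continuous_comp _ _ _ (fun z => k - z) (@sinh R)).
  by apply: cvgB; [exact: cvg_cst|exact: cvg_id].
exact: continuous_sinh.
Qed.

Lemma Rintegral_sinhB k a b : a <= b ->
  \int[mu]_(y in `[a, b]) sinh (k - y) =
  (expR (k - a) + expR (- (k - a))) / 2 - (expR (k - b) + expR (- (k - b))) / 2.
Proof.
move=> ab.
have dF y : is_derive y (1 : R)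
    (fun z => - 2^-1 * (expR (k - z) + expR (- (k - z)))) (sinh (k - y)).
  have -> : sinh (k - y) = - 2^-1 * (- expR (k - y) + expR (- (k - y))).
    by rewrite /sinh; field.
  apply: is_derive_scale; apply: is_deriveD.
  - exact: is_derive_expR_Br.
  - exact: is_derive_expR_Bl.
rewrite (@Rintegral_derive _ _ _ _ _ ab _ dF); last exact: continuous_sinhB.
by field.
Qed.

(** The kernel is split at its jump y = x. With -cosh as antiderivative in y, the two pieces give
    cosh(x - 1/2) - cosh(1/2) and its opposite. *)
Lemma dx_inv_op_cst c x : 0 <= x < 1 -> dx_inv_op (fun=> c) x = 0.
Proof.
move=> /andP[x0 x1]; rewrite /dx_inv_op.
have i1 : mu.-integrable `[0, 1] (EFin \o (fun y => dG (x - y))).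
  have -> : (fun y => dG (x - y)) = (fun y => dG (x - y) * 1).
    by apply/funext => y; rewrite mulr1.
  by apply: dG_integrable; exact: cst_continuous.
rewrite RintegralZr// (Rintegral_segment_cat x0 (ltW x1))//.
pose d : R := (2 * sinh 2^-1)^-1.
have -> : \int[mu]_(y in `[0, x]) dG (x - y) =
    (\int[mu]_(y in `[0, x]) sinh (x - 2^-1 - y)) * d.
  rewrite -(Rintegral_continuousZr _ _ _ (@continuous_sinhB _)).
  apply: eq_Rintegral => y; rewrite inE/= in_itv/= => /andP[y0 yx].
  have -> : x - 2^-1 - y = x - y - 2^-1 by lra.
  by apply: dG_ge0E; lra.
have -> : \int[mu]_(y in `[x, 1]) dG (x - y) =
    (\int[mu]_(y in `[x, 1]) sinh (x + 2^-1 - y)) * d.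
  rewrite -(Rintegral_continuousZr _ _ _ (@continuous_sinhB _)).
  (* The point y = x is removed: there [dG] takes its right limit, which differs from the value of
     the branch used on ]x, 1]. *)
  have i2 : mu.-integrable `]x, 1] (EFin \o (fun y => dG (x - y))).
    by apply: integrableS i1 => //; apply: subset_itv; rewrite bnd_simp.
  have i3 : mu.-integrable `]x, 1] (EFin \o (fun y => sinh (x + 2^-1 - y) * d)).
    have cs : continuous (fun y => sinh (x + 2^-1 - y) * d).
      by apply: continuous_mulf; [exact: continuous_sinhB|exact: cst_continuous].
    apply: integrableS (@continuous_integrable _ _ x 1 cs) => //.
    by apply: subset_itvr; rewrite bnd_simp.
  rewrite -(Rintegral_itv_obnd_cbnd i2) -(Rintegral_itv_obnd_cbnd i3).
  apply: eq_Rintegral => y; rewrite inE/= in_itv/= => /andP[y0 yx].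
  have -> : x + 2^-1 - y = x - y + 2^-1 by lra.
  by apply: dG_lt0E; lra.
rewrite !Rintegral_sinhB ?(ltW x1)//.
have -> : x - 2^-1 - 0 = x - 2^-1 by lra.
have -> : x + 2^-1 - 1 = x - 2^-1 by lra.
have -> : x - 2^-1 - x = - 2^-1 by lra.
have -> : x + 2^-1 - x = 2^-1 by lra.
by rewrite opprK; ring.
Qed.

(** Here b - y and a - y fall on different branches; the arguments of [sinh] are b - y - 1/2 and a -
    y + 1/2, the second exceeding the first by 1 - (b - a). *)
Lemma dGB_inner a b y : 0 <= a -> b < 1 -> a < y < b ->
  dG (b - y) - dG (a - y) <= - ((1 - (b - a)) / (8 * sinh 2^-1)).
Proof.
move=> a0 b1 /andP[ay yb]; have s0 := sinh_half_gt0.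
rewrite dG_ge0E ?dG_lt0E; [|lra..].
have -> : 8 * sinh 2^-1 = 4 * (2 * sinh 2^-1) :> R by ring.
have D0 : 0 < 2 * sinh 2^-1 :> R by rewrite mulr_gt0.
rewrite -mulrBl; move: (2 * sinh 2^-1) D0 => D D0.
rewrite -[leRHS]mulNr invfM mulrA ler_pM2r ?invr_gt0//.
have h1 : - 2^-1 <= b - y - 2^-1 by lra.
have h2 : b - y - 2^-1 <= a - y + 2^-1 by lra.
by have := sinhB_ge h1 h2; lra.
Qed.

(** Here b - y and a - y fall on the same branch, so the arguments of [sinh] differ by b - a. *)
Lemma dGB_outer a b y : 0 <= a -> a < b -> b < 1 -> 0 <= y <= 1 ->
  y < a \/ b < y -> (b - a) / (8 * sinh 2^-1) <= dG (b - y) - dG (a - y).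
Proof.
move=> a0 ab b1 /andP[y0 y1] yab; have s0 := sinh_half_gt0.
have -> : 8 * sinh 2^-1 = 4 * (2 * sinh 2^-1) :> R by ring.
have D0 : 0 < 2 * sinh 2^-1 :> R by rewrite mulr_gt0.
case: yab => [ya|yb].
- rewrite !dG_ge0E; [|lra..].
  rewrite -mulrBl; move: (2 * sinh 2^-1) D0 => D D0.
  rewrite invfM mulrA ler_pM2r ?invr_gt0//.
  have h1 : - 2^-1 <= a - y - 2^-1 by lra.
  have h2 : a - y - 2^-1 <= b - y - 2^-1 by lra.
  by have := sinhB_ge h1 h2; lra.
- rewrite !dG_lt0E; [|lra..].
  rewrite -mulrBl; move: (2 * sinh 2^-1) D0 => D D0.
  rewrite invfM mulrA ler_pM2r ?invr_gt0//.
  have h1 : - 2^-1 <= a - y + 2^-1 by lra.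
  have h2 : a - y + 2^-1 <= b - y + 2^-1 by lra.
  by have := sinhB_ge h1 h2; lra.
Qed.

(* The kernel y |-> dG (b - y) - dG (a - y) has the sign of h and is bounded
   away from 0, so the integral controls the L^1 norm of h. *)
Lemma dx_inv_op_rigidity h a b : continuous h -> 0 <= a -> a < b -> b < 1 ->
  h a = 0 -> h b = 0 ->
  (forall y, a <= y <= b -> h y <= 0) ->
  (forall y, 0 <= y <= 1 -> ~~ (a <= y <= b) -> 0 <= h y) ->
  dx_inv_op h b <= dx_inv_op h a ->
  forall y, 0 <= y <= 1 -> h y = 0.
Proof.
move=> ch a0 ab b1 ha hb hin hout hba.
have s0 := sinh_half_gt0.
pose k : R := Num.min (b - a) (1 - (b - a)) / (8 * sinh 2^-1).
have k0 : 0 < k.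
  apply: divr_gt0; last by apply: mulr_gt0 s0; rewrite ltr0n.
  by rewrite lt_min !subr_gt0 ab/= ltrBlDr (lt_le_trans b1)// lerDl.
have k1 : k <= (b - a) / (8 * sinh 2^-1).
  by rewrite ler_pM2r ?invr_gt0 ?mulr_gt0// ge_min lexx.
have k2 : k <= (1 - (b - a)) / (8 * sinh 2^-1).
  by rewrite ler_pM2r ?invr_gt0 ?mulr_gt0// ge_min lexx orbT.
have ptw y : 0 <= y <= 1 -> k * `|h y| <= dG (b - y) * h y - dG (a - y) * h y.
  move=> y01; rewrite -mulrBl.
  have [yab|yab] := boolP (a <= y <= b).
    (* [dGB_inner] needs y strictly between a and b; at the two endpoints h vanishes. *)
    have [->|ya] := eqVneq y a; first by rewrite ha normr0 !mulr0.
    have [->|yb] := eqVneq y b; first by rewrite hb normr0 !mulr0.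
    have := hin _ yab; have /andP[y1 y2] := yab => hy.
    have := @dGB_inner a b y a0 b1.
    rewrite !lt_neqAle eq_sym ya yb y1 y2 => /(_ isT) H.
    by rewrite ler0_norm// mulrN -mulNr ler_wnM2r// (le_trans H)// lerN2.
  have hy := hout _ y01 yab.
  have := @dGB_outer a b y a0 ab b1 y01.
  have yab' : y < a \/ b < y by move: yab; rewrite negb_and -!ltNge => /orP.
  by move=> /(_ yab') H; rewrite ger0_norm// ler_wpM2r// (le_trans k1).
have H : k * \int[mu]_(y in `[0, 1]) `|h y| <= 0.
  rewrite -RintegralZl//; last by apply: continuous_integrable; solve_continuous.
  apply: (@le_trans _ _ (dx_inv_op h b - dx_inv_op h a)); last by rewrite subr_le0.
  rewrite /dx_inv_op -RintegralB//; try exact: dG_integrable.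
  apply: le_Rintegral => //.
  - by apply: continuous_integrable; solve_continuous.
  - by apply: (integrableB _ (dG_integrable b ch) (dG_integrable a ch)).
move=> y y01; apply/eqP; rewrite -normr_eq0; apply/eqP.
apply: (@Rintegral_le0_eq0 _ (fun y => `|h y|)) => //; first by solve_continuous.
by rewrite -(ler_pM2l k0) mulr0.
Qed.

End GreenKernel.

(** * Solutions *)

Section SignedIntegral.
Context {R : realType}.
Notation mu := (@lebesgue_measure R).
Implicit Types (f : R -> R) (a b M : R).

Lemma Rintegral_segment_norm_le f a b M : a <= b ->
  mu.-integrable `[a, b] (EFin \o f) ->
  (forall t, a <= t <= b -> `|f t| <= M) ->
  `|\int[mu]_(t in `[a, b]) f t| <= M * (b - a).
Proof.
move=> ab fi fM; apply: (le_trans (le_normr_Rintegral _ fi)) => //.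
rewrite -Rintegral_segment_cst//; apply: le_Rintegral => //.
- exact: (integrable_norm fi).
- by apply: continuous_integrable; exact: cst_continuous.
Qed.

Lemma integral_from0B f T a b : - T <= a -> a <= b -> b <= T ->
  mu.-integrable `[- T, T] (EFin \o f) ->
  integral_from0 f b - integral_from0 f a = \int[mu]_(t in `[a, b]) f t.
Proof.
move=> Ta ab bT fi.
have fi' c d : - T <= c -> d <= T -> mu.-integrable `[c, d] (EFin \o f).
  by move=> Tc dT; apply: integrableS fi => //; apply: subset_itv; rewrite bnd_simp.
rewrite /integral_from0; case: (leP 0 b) => b0; case: (leP 0 a) => a0.
- rewrite (Rintegral_segment_cat a0 ab); first by rewrite addrC addKr.
  by apply: fi' => //; lra.
- rewrite opprK (Rintegral_segment_cat (ltW a0) b0); first by rewrite addrC.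
  exact: fi'.
- by have := le_lt_trans (le_trans a0 ab) b0; rewrite ltxx.
- rewrite opprK (Rintegral_segment_cat ab (ltW b0)); first by rewrite addrC addrK.
  by apply: fi' => //; lra.
Qed.

End SignedIntegral.

Lemma periodic_floor (R : archiRealDomainType) (V : zmodType) (v : R -> V) (x : R) :
  periodic v 1 -> v x = v (x - (Num.floor x)%:~R).
Proof.
move=> pv; have pz (z : int) y : v (y + z%:~R) = v y.
  case: z => n; first exact: (periodicn pv).
  rewrite NegzE mulrNz -[in RHS](subrK (n.+1%:R) y).
  by rewrite (periodicn pv n.+1 (y - n.+1%:R)).
by rewrite -[in RHS](pz (Num.floor x)) subrK.
Qed.

Section Solution.
Context {R : realType} (s T : R) (u0 : R -> R) (u : R -> R -> R).
Hypotheses (s0 : 0 <= s) (T0 : 0 < T) (hu : bbm_solution s T u0 u).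
Notation mu := (@lebesgue_measure R).
Implicit Types (a b x y t e M : R) (v w : R -> R).

Let h t y := flux (u y t).
Let g x t := dx_inv_op (h t) x.

Let u_continuous t : t \in `[- T, T] -> continuous (u^~ t).
Proof. by case: hu => _ + _; apply. Qed.

Let u_periodic t : t \in `[- T, T] -> periodic (u^~ t) 1.
Proof. by case: hu => -[+ _] _ _ => /[apply] -[]. Qed.

Lemma flux_continuous v : continuous v -> continuous (fun x => flux (v x)).
Proof. by move=> cv; rewrite /flux; solve_continuous. Qed.

Let h_continuous t : t \in `[- T, T] -> continuous (h t).
Proof. by move=> tT; apply: flux_continuous; exact: u_continuous. Qed.

(** With d = w - v, the flux difference is d (1 + v) + d^2/2, and |d| <= e/2 + d^2/(2e) by Young's
    inequality. The free parameter e lets a small L^2 distance force a small L^1 distance. *)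
Lemma Rintegral_flux_dist v w M e : continuous v -> continuous w -> 0 < e ->
  (forall x, 0 <= x <= 1 -> `|1 + v x| <= M) ->
  \int[mu]_(x in `[0, 1]) `|flux (w x) - flux (v x)| <=
  M * e / 2 + (M / (2 * e) + 2^-1) * \int[mu]_(x in `[0, 1]) (w x - v x) ^+ 2.
Proof.
move=> cv cw e0 vM.
have -> : M * e / 2 = \int[mu]_(x in `[0, 1]) (M * e / 2).
  by rewrite Rintegral_segment_cst// subr0 mulr1.
rewrite [X in _ + X]mulrC -Rintegral_continuousZr; last by solve_continuous.
rewrite -RintegralD//; try by apply: continuous_integrable; solve_continuous.
have cfv := flux_continuous cv; have cfw := flux_continuous cw.
apply: le_Rintegral => //; try by apply: continuous_integrable; solve_continuous.
move=> x; rewrite /= in_itv/= => /vM vMx.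
have -> : flux (w x) - flux (v x) = (w x - v x) * (1 + v x) + (w x - v x) ^+ 2 / 2.
  by rewrite /flux; field.
move: (w x - v x) => d.
have d2 : 0 <= d ^+ 2 by exact: sqr_ge0.
apply: (le_trans (ler_normD _ _)).
rewrite normrM (ger0_norm (_ : 0 <= d ^+ 2 / 2)); last by rewrite divr_ge0.
have M0 : 0 <= M by apply: le_trans vMx.
have dE : `|d| <= e / 2 + d ^+ 2 / (2 * e).
  have -> : e / 2 + d ^+ 2 / (2 * e) = (e ^+ 2 + `|d| ^+ 2) / (2 * e).
    by rewrite real_normK ?num_real//; field; rewrite gt_eqF.
  rewrite ler_pdivlMr ?mulr_gt0//.
  by have := sqr_ge0 (e - `|d|); lra.
have : `|d| * `|1 + v x| <= (e / 2 + d ^+ 2 / (2 * e)) * M by exact: ler_pM.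
by lra.
Qed.

Lemma flux_L1_continuous t e : t \in `[- T, T] -> 0 < e ->
  \forall tau \near within [set` `[- T, T]] (nbhs t),
    \int[mu]_(y in `[0, 1]) `|h tau y - h t y| <= e.
Proof.
move=> tT e0; have cut := u_continuous tT.
have [M M1 uM] : exists2 M : R, 1 <= M & forall x, 0 <= x <= 1 -> `|1 + u x t| <= M.
  have cnv : {within `[0, 1], continuous (fun x => `|1 + u x t|)}.
    by apply: continuous_subspaceT; solve_continuous.
  have [c _ hc] := EVT_max ler01 cnv.
  exists (`|1 + u c t| + 1) => [|x x01]; first by rewrite lerDr.
  by rewrite ler_wpDr// hc// in_itv.
have M0 : 0 < M by lra.
(* The coefficient of the L^2 term in [Rintegral_flux_dist] for the parameter e / M, whose other
   term is then e / 2. Below, d <= 1 gives K d^2 <= K d <= e / 2. *)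
pose K : R := M / (2 * (e / M)) + 2^-1.
have K0 : 0 < K by rewrite addr_gt0// divr_gt0// mulr_gt0// divr_gt0.
pose d := Num.min 1 (e / (2 * K)).
have d0 : 0 < d by rewrite lt_min ltr01 divr_gt0// mulr_gt0.
have dK : K * d ^+ 2 <= e / 2.
  have d1 : d <= 1 by rewrite ge_min lexx.
  have d2 : d <= e / (2 * K) by rewrite ge_min lexx orbT.
  have : K * d <= e / 2.
    have -> : e / 2 = K * (e / (2 * K)) by field; rewrite gt_eqF.
    by rewrite ler_pM2l.
  by apply: le_trans; rewrite ler_pM2l// expr2 ler_piMl// ltW.
have small : \forall tau \near within [set` `[- T, T]] (nbhs t),
    (sobolev_norm s (fun x => (u x tau - u x t)%R) < d%:E)%E.
  have [[_ /(_ t tT) H] _ _] := hu.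
  exact: (H _ (nbhs_open_ereal_lt (f := fun=> d) d0)).
near=> tau.
have tauT : tau \in `[- T, T] by near: tau; exact: withinT.
have cutau := u_continuous tauT.
have L2 : \int[mu]_(x in `[0, 1]) (u x tau - u x t) ^+ 2 <= d ^+ 2.
  apply: (@sobolev_norm_L2 _ s) => //.
  - by solve_continuous.
  - by move=> x; rewrite (u_periodic tauT) (u_periodic tT).
  - by near: tau.
have eM : 0 < e / M by rewrite divr_gt0.
apply: (le_trans (Rintegral_flux_dist cut cutau eM uM)); rewrite -/K.
have -> : M * (e / M) / 2 = e / 2 by field; rewrite gt_eqF.
have := ler_wpM2l (ltW K0) L2; lra.
Unshelve. all: by end_near. Qed.

Let g_continuous x : {within `[- T, T], continuous (g x)}.
Proof.
apply/subspace_continuousP => t tT; apply/cvgrPdist_le => e e0.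
near=> tau.
have tauT : tau \in `[- T, T] by near: tau; exact: withinT.
rewrite distrC /g dx_inv_opB; [|exact: h_continuous..].
apply: (le_trans (dx_inv_op_norm _ _)).
  apply: continuous_addf; first exact: h_continuous.
  by apply: continuous_oppf; exact: h_continuous.
by near: tau; exact: flux_L1_continuous.
Unshelve. all: by end_near. Qed.

Let g_integrable x : mu.-integrable `[- T, T] (EFin \o g x).
Proof.
apply: continuous_compact_integrable; first exact: segment_compact.
exact: g_continuous.
Qed.

(** As |dG| <= 1, the L^1 norm of the flux bounds g uniformly in x; it is continuous in time, hence
    has a maximum on [-T, T]. *)
Let g_bounded : exists M, forall x t, t \in `[- T, T] -> `|g x t| <= M.
Proof.
pose q t : R := \int[mu]_(y in `[0, 1]) `|h t y|.
have cq : {within `[- T, T], continuous q}.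
  apply/subspace_continuousP => t tT; apply/cvgrPdist_le => e e0.
  near=> tau.
  have tauT : tau \in `[- T, T] by near: tau; exact: withinT.
  have ct := h_continuous tT; have ctau := h_continuous tauT.
  rewrite distrC /q -RintegralB//;
    try by apply: continuous_integrable; solve_continuous.
  apply: (@le_trans _ _ (\int[mu]_(y in `[0, 1]) `|h tau y - h t y|)).
    apply: (le_trans (le_normr_Rintegral _ _)) => //.
      by apply: continuous_integrable; solve_continuous.
    apply: le_Rintegral => //; try by apply: continuous_integrable; solve_continuous.
    by move=> y _; exact: ler_dist_dist.
  by near: tau; exact: flux_L1_continuous.
have TT : - T <= T by rewrite ge0_cp// ltW.
have [c _ hc] := EVT_max TT cq.
exists (q c) => x t tT; apply: le_trans (hc t tT).
by apply: dx_inv_op_norm; exact: h_continuous.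
Unshelve. all: by end_near. Qed.

Let uB x a b : - T <= a -> a <= b -> b <= T ->
  u x b - u x a = - \int[mu]_(t in `[a, b]) g x t.
Proof.
move=> Ta ab bT; case: hu => _ _ E.
rewrite -(integral_from0B Ta ab bT (g_integrable x)) !E ?in_itv/=; last 2 first.
- by rewrite Ta (le_trans ab).
- by rewrite bT (le_trans Ta).
by rewrite /g /h; ring.
Qed.

(** The bound M is required only at times no farther from a than b is, so that estimates on a short
    time window can be fed back in [solution_constant]. *)
Lemma solution_time_lipschitz x a b M : a \in `[- T, T] -> b \in `[- T, T] ->
  (forall t, t \in `[- T, T] -> `|t - a| <= `|b - a| -> `|dx_inv_op (h t) x| <= M) ->
  `|u x b - u x a| <= M * `|b - a|.
Proof.
rewrite !in_itv/= => /andP[Ta aT] /andP[Tb bT] gM.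
have [ab|ba] := leP a b.
  rewrite uB// normrN (ger0_norm (_ : 0 <= b - a)) ?subr_ge0//.
  apply: Rintegral_segment_norm_le => //.
    by apply: integrableS (g_integrable x) => //; apply: subset_itv; rewrite bnd_simp.
  move=> t /andP[at_ tb]; apply: gM; first by rewrite in_itv/=; lra.
  by rewrite !ger0_norm ?subr_ge0//; lra.
rewrite distrC uB ?(ltW ba)// normrN distrC (gtr0_norm (_ : 0 < a - b)) ?subr_gt0//.
apply: Rintegral_segment_norm_le => //; first exact: ltW.
  by apply: integrableS (g_integrable x) => //; apply: subset_itv; rewrite bnd_simp.
move=> t /andP[bt ta]; apply: gM; first by rewrite in_itv/=; lra.
by rewrite !ler0_norm ?subr_le0//; lra.
Qed.

Lemma solution_derive1 x t : - T < t < T -> derive1 (u x) t = - dx_inv_op (h t) x.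
Proof.
move=> /andP[Tt tT].
have ct : {for t, continuous (g x)}.
  have TT : - T < T := lt_trans Tt tT.
  apply: (within_continuous_continuous TT (@g_continuous x) _).
  by rewrite in_itv/= Tt.
have [dF F'] := continuous_FTC1_closed tT (g_integrable x) Tt ct.
(* Basing the integral at -T replaces the signed integral from 0 by an ordinary one, to which the
   fundamental theorem of calculus applies. *)
have H : is_derive t (1 : R)
    (fun b => u x (- T) - \int[mu]_(t in `[- T, b]) g x t) (- g x t).
  have := is_deriveB (is_derive_cst (u x (- T)) t (1 : R)) (DeriveDef dF erefl).
  by rewrite sub0r -derive1E F'.
rewrite derive1E; apply: derive_val; apply: near_eq_is_derive H.
near=> b.
have bT : - T <= b <= T.
  apply/andP; split; near: b.
    by apply: filterS (lt_nbhsr Tt) => z; exact: ltW.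
  by apply: filterS (lt_nbhsl tT) => z; exact: ltW.
have /andP[Tb bT'] := bT.
by have /eqP := uB x (lexx _) Tb bT'; rewrite subr_eq addrC => /eqP ->.
Unshelve. all: by end_near. Qed.

(** Subtracting the constant [flux c] does not change the operator, since [dG] has mean zero. What
    remains factors as (1 + c + (u - c)/2) (u - c). *)
Let h_bound c B t K x : t \in `[- T, T] -> (forall y, `|u y t - c| <= K) ->
  K <= B -> 0 <= x < 1 -> `|dx_inv_op (h t) x| <= (1 + `|c| + B / 2) * K.
Proof.
move=> tT uK KB x01; have cc := @cst_continuous R R (flux c).
have ch := h_continuous tT.
have -> : dx_inv_op (h t) x = dx_inv_op (fun y => h t y - flux c) x.
  by rewrite -dx_inv_opB// dx_inv_op_cst// subr0.
apply: (le_trans (dx_inv_op_norm _ _)); first by solve_continuous.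
have -> : (1 + `|c| + B / 2) * K = \int[mu]_(y in `[0, 1]) ((1 + `|c| + B / 2) * K).
  by rewrite Rintegral_segment_cst// subr0 mulr1.
apply: le_Rintegral => //; try by apply: continuous_integrable; solve_continuous.
move=> y _; have uy := uK y.
have -> : h t y - flux c = (1 + c + (u y t - c) / 2) * (u y t - c).
  by rewrite /h /flux; field.
rewrite normrM; apply: ler_pM => //.
apply: (le_trans (ler_normD _ _)); apply: lerD.
  by apply: (le_trans (ler_normD _ _)); rewrite normr1.
by rewrite normrM (ger0_norm (_ : 0 <= 2^-1))// ler_pM2r// (le_trans uy).
Qed.

(* Over a time step of length 1/(2L), where L bounds the Lipschitz constant of
   the flux, a bound on the distance to c improves by a factor 2. *)
Lemma solution_constant c t t' : t \in `[- T, T] -> (forall x, u x t = c) ->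
  t' \in `[- T, T] -> forall x, u x t' = c.
Proof.
move=> tT utc t'T.
have [Q hQ] := g_bounded.
have Q0 : 0 <= Q by apply: le_trans (hQ 0 t tT).
have D2 a b : a \in `[- T, T] -> b \in `[- T, T] -> `|a - b| <= 2 * T.
  by rewrite !in_itv/= => aT bT; rewrite ler_norml; lra.
pose B := Q * (2 * T); pose L := 1 + `|c| + B / 2.
have B0 : 0 <= B by rewrite !mulr_ge0// ltW.
have L0 : 0 < L by rewrite /L -addrA ltr_wpDr// addr_ge0// divr_ge0.
have uB0 a x : a \in `[- T, T] -> `|u x a - c| <= B.
  move=> aT; rewrite -(utc x).
  apply: (le_trans (@solution_time_lipschitz x t a Q tT aT _)).
    by move=> r rT _; exact: hQ.
  by rewrite ler_wpM2l// D2.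
have step a : a \in `[- T, T] -> (forall x, u x a = c) -> forall n b,
    b \in `[- T, T] -> `|b - a| <= (2 * L)^-1 ->
    forall x, `|u x b - c| <= B / 2 ^+ n.
  move=> aT ua; elim=> [|n IH] b bT ab x; first by rewrite expr0 divr1 uB0.
  (* [h_bound] is available for positions in [0, 1[ only. *)
  rewrite (periodic_floor x (u_periodic bT)).
  set z := x - _.
  have z01 : 0 <= z < 1.
    have := floor_itv x; rewrite intrD /z => /andP[x1 x2].
    by rewrite subr_ge0 x1 ltrBlDl.
  rewrite -(ua z).
  have BnB : B / 2 ^+ n <= B.
    by rewrite ler_pdivrMr ?exprn_gt0// ler_peMr// exprn_ege1// ler1n.
  have Bn0 : 0 <= B / 2 ^+ n by rewrite divr_ge0// exprn_ge0.
  apply: (le_trans (@solution_time_lipschitz z a b (L * (B / 2 ^+ n)) aT bT _)).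
    (* The intermediate time r is at least as close to a as b is, so the induction hypothesis covers
       it. *)
    move=> r rT ra; apply: h_bound => // y.
    by apply: IH => //; apply: le_trans ab.
  have -> : B / 2 ^+ n.+1 = L * (B / 2 ^+ n) * (2 * L)^-1.
    by rewrite exprS; field; rewrite gt_eqF// expf_neq0.
  by rewrite ler_wpM2l// mulr_ge0// ltW.
have propagate a : a \in `[- T, T] -> (forall x, u x a = c) -> forall b,
    b \in `[- T, T] -> `|b - a| <= (2 * L)^-1 -> forall x, u x b = c.
  move=> aT ua b bT ab x; apply/eqP; rewrite -subr_eq0 -normr_eq0.
  rewrite eq_le normr_ge0 andbT leNgt; apply/negP => d0.
  (* With d the supposed nonzero distance, B < d n and n < 2^n contradict d <= B / 2^n. *)
  pose n := (Num.truncn (B / `|u x b - c|)).+1.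
  have Bn : B < `|u x b - c| * n%:R.
    by rewrite mulrC -ltr_pdivrMr//; exact: truncnS_gt.
  have := step a aT ua n b bT ab x.
  rewrite ler_pdivlMr ?exprn_gt0// leNgt (lt_le_trans Bn)//.
  by rewrite ler_pM2l// -natrX ler_nat ltnW// ltn_expl.
(* Enough equal steps from t to t' for each to have length at most 1/(2L), because |t' - t| <=
   2T. *)
pose n := (Num.truncn (2 * T * (2 * L))).+1.
have n0 : 0 < n%:R :> R by rewrite ltr0n.
have tn : `|t' - t| / n%:R <= (2 * L)^-1.
  have L2 : 0 < 2 * L by rewrite mulr_gt0.
  rewrite ler_pdivrMr// mulrC ler_pdivlMr//.
  apply: (@le_trans _ _ (2 * T * (2 * L))); first by rewrite ler_pM2r// D2.
  by apply: ltW; exact: truncnS_gt.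
have walk k : (k <= n)%N -> forall x, u x (t + k%:R / n%:R * (t' - t)) = c.
  have inT j : (j <= n)%N -> t + j%:R / n%:R * (t' - t) \in `[- T, T].
    move=> jn; have : 0 <= j%:R / n%:R :> R by rewrite divr_ge0// ler0n.
    have : j%:R / n%:R <= 1 :> R by rewrite ler_pdivrMr// mul1r ler_nat.
    move: tT t'T; rewrite !in_itv/=; move: (j%:R / n%:R) => r.
    move=> /andP[t1 t2] /andP[t3 t4] r1 r0; apply/andP; split; nra.
  elim: k => [_ x|k IH kn]; first by rewrite mul0r mul0r addr0 utc.
  apply: (propagate (t + k%:R / n%:R * (t' - t)));
    [exact/inT/ltnW|exact/IH/ltnW|exact: inT|].
  have -> : t + k.+1%:R / n%:R * (t' - t) - (t + k%:R / n%:R * (t' - t)) =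
      (t' - t) / n%:R.
    by rewrite -natr1; field; rewrite gt_eqF.
  by rewrite normrM normfV (ger0_norm (ltW n0)).
move=> x; have := walk n (leqnn n) x.
by rewrite divff ?gt_eqF// mul1r addrC subrK.
Qed.

End Solution.

(** * Unique continuation *)

(* A level set of the flux has at most two points, c and - 2 - c, and a
   continuous function jumping between them would cross the vertex -1. *)
Lemma flux_level (R : realType) (v : R -> R) (a c : R) : continuous v -> v a = c ->
  (forall x, flux (v x) = flux c) -> forall x, v x = c.
Proof.
move=> cv va fv x.
have dich y : v y = c \/ v y = - 2 - c.
  have : (v y - c) * (v y + c + 2) = 0.
    have -> : (v y - c) * (v y + c + 2) = 2 * (flux (v y) - flux c).
      by rewrite /flux; field.
    by rewrite fv subrr mulr0.
  by move/eqP; rewrite mulf_eq0 => /orP[/eqP H|/eqP H]; [left|right]; lra.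
have [//|vx] := dich x.
have cw p q : {within `[p, q], continuous v} by exact: continuous_subspaceT.
have [z vz] : exists z, v z = - 1.
  have minmax : Num.min c (- 2 - c) <= - 1 <= Num.max c (- 2 - c).
    by rewrite ge_min le_max; lra.
  have [ax|xa] := leP a x.
    have [|z _ vz] := IVT (v := - 1) ax (@cw a x); first by rewrite va vx.
    by exists z.
  have [|z _ vz] := IVT (v := - 1) (ltW xa) (@cw x a).
    by rewrite va vx minC maxC.
  by exists z.
(* The value -1 being c or -2 - c, either way c = -1, and the two candidate values coincide. *)
have := dich z; rewrite vz vx => -[]; lra.
Qed.

Theorem theorem1p11 (R : realType) (c0 s T : R) (hs : 2^-1 < s) (hT : 0 < T)
    (u0 : R -> R) (hu0 : in_sobolev s u0)
    (u : R -> R -> R) (hu : bbm_solution s T u0 u)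
    (t0 a b : R) (ht0 : - T < t0 < T)
    (ha : 0 <= a < 1) (hb : 0 <= b < 1) (hab : a < b)
    (hua : u a t0 = c0) (hub : u b t0 = c0)
    (hcond :
      [/\ forall x : R, a <= x <= b -> flux (u x t0) <= flux c0,
          forall x : R, 0 <= x < 1 -> ~~ (a <= x <= b) ->
            flux c0 <= flux (u x t0)
        & derive1 (u a) t0 <= derive1 (u b) t0] \/
      [/\ forall x : R, 0 <= x < 1 -> ~~ (a <= x <= b) ->
            flux (u x t0) <= flux c0,
          forall x : R, a <= x <= b -> flux c0 <= flux (u x t0)
        & derive1 (u b) t0 <= derive1 (u a) t0]) :
  forall x t : R, - T <= t <= T -> u x t = c0.
Proof.
have s0 : 0 <= s by apply: ltW; apply: lt_trans hs; rewrite invr_gt0.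
have t0T : t0 \in `[- T, T] by rewrite in_itv/=; move: ht0; lra.
have [[Hsob _] Hcont _] := hu.
have cu := Hcont t0 t0T; have [pu _ _] := Hsob t0 t0T.
have cf := flux_continuous cu; have cc := @cst_continuous R R (flux c0).
have /andP[a0 a1] := ha; have /andP[b0 b1] := hb.
pose h y := flux (u y t0) - flux c0.
have ch : continuous h by rewrite /h; solve_continuous.
have h_a : h a = 0 by rewrite /h hua subrr.
have h_b : h b = 0 by rewrite /h hub subrr.
have h1 : h 1 = h 0 by rewrite /h -[1]add0r pu.
have dh x : 0 <= x < 1 -> dx_inv_op h x = - derive1 (u x) t0.
  move=> x01; rewrite (solution_derive1 s0 hu)// opprK.
  by rewrite -dx_inv_opB// dx_inv_op_cst// subr0.
have dhN x : dx_inv_op (fun y => - h y) x = - dx_inv_op h x.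
  have c00 := @cst_continuous R R (0 : R).
  have := dx_inv_opB x c00 ch.
  rewrite /dx_inv_op; under [in X in X - _]eq_Rintegral do rewrite mulr0.
  rewrite Rintegral_segment_cst// mul0r sub0r => ->.
  by apply: eq_Rintegral => y _; rewrite sub0r.
(* The conditions are stated on [0, 1[; periodicity carries them to 1. *)
have out01 (P : R -> Prop) : P 0 ->
    (forall y, 0 <= y < 1 -> ~~ (a <= y <= b) -> P (h y)) ->
    forall y, 0 <= y <= 1 -> ~~ (a <= y <= b) -> P (h y).
  move=> P0 Pout y /andP[y0]; rewrite le_eqVlt => /predU1P[-> _|y1 yab]; last first.
    by apply: Pout => //; rewrite y0.
  (* If 0 lies in [a, b] then a = 0, so h 1 = h 0 = h a = 0. *)
  rewrite h1; have [/andP[a0' _]|H] := boolP (a <= 0 <= b).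
    by have <- : a = 0; [apply/eqP; rewrite eq_le a0 a0'|rewrite h_a].
  by apply: Pout => //; rewrite lexx ltr01.
have hz : forall y, 0 <= y <= 1 -> h y = 0.
  case: hcond => -[H1 H2 H3].
  - apply: (dx_inv_op_rigidity ch a0 hab b1 h_a h_b).
    + by move=> y /H1; rewrite /h subr_le0.
    + apply: (out01 (fun r => 0 <= r)) => // y y01 yab.
      by rewrite /h subr_ge0 H2.
    + by rewrite !dh// lerN2.
  (* The second condition is the first one for -h. *)
  - have cN : continuous (fun y => - h y) by exact: continuous_oppf.
    have hN : forall y, 0 <= y <= 1 -> - h y = 0.
      apply: (dx_inv_op_rigidity cN a0 hab b1).
      + by rewrite h_a oppr0.
      + by rewrite h_b oppr0.
      + by move=> y /H2; rewrite /h oppr_le0 subr_ge0.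
      + apply: (out01 (fun r => 0 <= - r)); first by rewrite oppr0.
        by move=> y y01 yab; rewrite /h oppr_ge0 subr_le0 H1.
      + by rewrite !dhN !dh// !opprK.
    by move=> y y01; apply/eqP; rewrite -oppr_eq0 hN.
have ut0 : forall x, u x t0 = c0.
  apply: (flux_level cu hua) => x; rewrite (periodic_floor x pu).
  apply/eqP; rewrite -subr_eq0; apply/eqP/hz.
  have /andP[x1 x2] := floor_itv x; rewrite intrD in x2.
  by rewrite subr_ge0 x1 ltW// ltrBlDl.
move=> x t tT; apply: (solution_constant s0 hT hu t0T ut0).
by rewrite in_itv.
Qed.
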